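(* Fix an approximation weight $\mathsf W$ satisfying $L/\mathsf W\in L^1_\mu(D)$ and $\mathsf W^{-1}\in L^2_\mu(D)$, and assume that $(\mu,\rho_{\mathrm{ind}},V,\mathcal L)$ satisfies the relative admissibility condition, where $\rho_{\mathrm{ind}}$ is the induced sampling measure $d\rho_{\mathrm{ind}}=\frac{k}{N}\,d\mu$. Then, for every $\theta\in(0,1)$, the tuple $(\mu,\rho_\theta,V,\mathcal L)$, where $d\rho_\theta=\tau_\theta^2\,d\mu$ with $$\tau_\theta^2(x)=\theta\frac{k(x)}{N}+(1-\theta)\frac{|L(x)|/\mathsf W(x)}{\|L/\mathsf W\|_{L^1_\mu(D)}},$$ satisfies both relative admissibility and reference-weight concentration with respect to $\mathsf W$.
   Context: Setting. $\mu$ is a positive measure with closed support $D$ in a Banach space; functions on $D$ are $\mu$-measurable, complex-valued and pointwise defined. $\langle u,v\rangle=\int_D\overline{u}\,v\,d\mu$ and $\|\cdot\|$ are the inner product and norm of $L^2_\mu(D)$. $V\subset L^2_\mu(D)$ is a subspace of finite complex dimension $N\geq 1$; an $L^2_\mu$-orthonormal basis of $V$ is fixed, with fixed measurable pointwise representatives $\varphi_1,\dots,\varphi_N$, and $V$ is identified with the space of pointwise-defined functions $\sum_n c_n\varphi_n$. Write $k(x)=\sum_{n=1}^N|\varphi_n(x)|^2$. $\mathcal L\in V^*$ is a nonzero linear functional, $L\in V$ is its Riesz representer ($\mathcal L(v)=\langle L,v\rangle$ for $v\in V$), and $\|\mathcal L\|_{V^*}=\|L\|$. An approximation weight is a positive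 measurable function $\mathsf W:D\to(0,\infty)$. For a sampling density, i.e. a measurable $\tau^2:D\to[0,\infty)$ with $\int_D\tau^2\,d\mu=1$ and $k(x)=0$ for $\mu$-almost every $x\in\{\tau^2=0\}$, and sampling measure $d\rho=\tau^2\,d\mu$: let $Q=\operatorname{ess\,sup}_{x\sim\rho}k(x)/\tau^2(x)$ (with $0/0=0$ and $a/0=+\infty$ for $a>0$). Relative admissibility. Let $\cos\gamma(x)=\frac{|L(x)|}{\|\mathcal L\|_{V^*}\sqrt{k(x)}}$ if $k(x)>0$ and $\cos\gamma(x)=1$ if $k(x)=0$. The tuple $(\mu,\rho,V,\mathcal L)$ is relatively admissible if $Q<\infty$ and $\lim_{\epsilon\to0^+}\epsilon^{-2}\Pr_{X\sim\rho}[\cos\gamma(X)\le\epsilon]=0$ (equivalently, $Jp_J\to0$ as $J\to\infty$, where $p_J=\Pr_{X\sim\rho}[1/\cos\gamma(X)\ge J^{1/2}]$). Reference-weight concentration. $\mathsf K_{\mathcal L,\rho,\mathsf W}(x)=\frac{|L(x)|}{\tau^2(x)\mathsf W(x)}$ (set to $0$ where $\tau^2(x)=0$). The tuple satisfies reference-weight concentration with respect to $\mathsf W$ if, for $X\sim\rho$, $\inf\{c>0:\mathbb E_\rho[\exp(\mathsf K_{\mathcal L,\rho,\mathsf W}(X)/c)]\le2\}<\infty$. *)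

(* Defs.v *)
From HB Require Import structures.
From mathcomp Require Import all_boot all_order all_algebra.
From mathcomp Require Import all_classical all_reals all_analysis.
From mathcomp Require Import measurable_realfun ess_sup_inf complex.

Set Implicit Arguments.
Unset Strict Implicit.
Unset Printing Implicit Defensive.

Import Order.TTheory GRing.Theory Num.Theory.
Import numFieldNormedType.Exports Normc.

Local Open Scope classical_set_scope.
Local Open Scope complex_scope.
Local Open Scope ring_scope.

(* Nothing is assumed about the mass outside the support: every integral below
   is restricted to D. *)
Definition closed_support (R : realType) (E : topologicalType)
    (mu : set E -> \bar R) : set E :=
  [set x | forall U : set E, open U -> U x -> (0 < mu U)%E].

Section complex_functions.
Context d (T : measurableType d) (R : realType).
Variables (mu : {measure set T -> \bar R}) (D : set T).
Implicit Types f u v : T -> R[i].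

(* R[i] has no measurable structure in the library. *)
Definition cmeasurable_fun f : Prop :=
  measurable_fun D (fun x => complex.Re (f x)) /\
  measurable_fun D (fun x => complex.Im (f x)).

Definition cintegral f : R[i] :=
  (\int[mu]_(x in D) complex.Re (f x)) +i* (\int[mu]_(x in D) complex.Im (f x)).

Definition cinner u v : R[i] := cintegral (fun x => (u x)^* * v x).

Definition cnorm u : R := Num.sqrt (complex.Re (cinner u u)).

Definition in_L1 f : Prop :=
  cmeasurable_fun f /\ (\int[mu]_(x in D) (normc (f x))%:E < +oo)%E.

Definition in_L2 f : Prop :=
  cmeasurable_fun f /\ (\int[mu]_(x in D) (normc (f x) ^+ 2)%:E < +oo)%E.

Definition L1norm f : R := \int[mu]_(x in D) normc (f x).

End complex_functions.

(* The measure tau2 dmu on D.  For the measure laws to hold without side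
   conditions, the density is replaced by 0 when it is not a measurable
   nonnegative function on D; see sampling_measureE. *)
Section sampling_measure.
Context d (T : measurableType d) (R : realType).
Variables (mu : {measure set T -> \bar R}) (D : set T) (tau2 : T -> R).

Definition density_on : T -> R :=
  if pselect [/\ measurable D, measurable_fun D tau2
               & forall x, D x -> 0 <= tau2 x]
  then tau2 \_ D else cst 0.

Lemma density_on_ge0 x : 0 <= density_on x.
Proof.
rewrite /density_on; case: pselect => [[mD mt t0]|//] /=; rewrite patchE.
by case: ifPn => // /set_mem; exact: t0.
Qed.

Lemma measurable_density_on : measurable_fun setT density_on.
Proof.
rewrite /density_on; case: pselect => [[mD mt t0]|_] /=; last exact: measurable_cst.
exact/(measurable_restrictT tau2 mD).
Qed.

Definition sampling_measure (A : set T) : \bar R :=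
  (\int[mu]_(x in A) (density_on x)%:E)%E.

Let rho0 : sampling_measure set0 = 0%E.
Proof. by rewrite /sampling_measure integral_set0. Qed.

Let rho_ge0 A : (0 <= sampling_measure A)%E.
Proof. by apply: integral_ge0 => x _; rewrite lee_fin density_on_ge0. Qed.

Let rho_sigma_additive : semi_sigma_additive sampling_measure.
Proof.
apply: semi_sigma_additive_nng_induced => [|x].
  apply/measurable_EFinP; exact: measurable_density_on.
by rewrite lee_fin density_on_ge0.
Qed.

HB.instance Definition _ := isMeasure.Build d T R sampling_measure
  rho0 rho_ge0 rho_sigma_additive.

Lemma sampling_measureE (A : set T) :
  measurable D -> measurable_fun D tau2 -> (forall x, D x -> 0 <= tau2 x) ->
  sampling_measure A = (\int[mu]_(x in A `&` D) (tau2 x)%:E)%E.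
Proof.
move=> mD mt t0; rewrite /sampling_measure /density_on.
case: pselect => [h|[]//] /=.
rewrite integral_mkcondr; apply: eq_integral => x _.
by rewrite !patchE; case: ifPn.
Qed.

End sampling_measure.

Section pointwise_functions.
Variables (T : Type) (R : realType) (N : nat) (phi : 'I_N -> T -> R[i]).

Definition span_of : set (T -> R[i]) :=
  [set v | exists c : 'I_N -> R[i], v = fun x => \sum_(n < N) c n * phi n x].

Definition linear_on (V : set (T -> R[i])) (ell : (T -> R[i]) -> R[i]) : Prop :=
  forall (a : R[i]) (u v : T -> R[i]), V u -> V v ->
    ell (fun x => a * u x + v x) = a * ell u + ell v.

Definition kfun (x : T) : R := \sum_(n < N) normc (phi n x) ^+ 2.

Definition induced_density (x : T) : R := kfun x / N%:R.

Definition kfun_ratio (tau2 : T -> R) (x : T) : \bar R :=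
  if tau2 x == 0 then (if kfun x == 0 then 0%E else +oo%E)
  else (kfun x / tau2 x)%:E.

End pointwise_functions.

Section sampling.
Context d (T : measurableType d) (R : realType).
Variables (mu : {measure set T -> \bar R}) (D : set T).
Variables (N : nat) (phi : 'I_N -> T -> R[i]).

Definition L2_orthonormal : Prop :=
  (forall n, in_L2 mu D (phi n)) /\
  (forall m n, cinner mu D (phi m) (phi n) = (m == n)%:R).

Definition dual_norm (V : set (T -> R[i])) (ell : (T -> R[i]) -> R[i]) : R :=
  sup [set normc (ell v) | v in [set v | V v /\ cnorm mu D v <= 1]].

Definition riesz_representer (V : set (T -> R[i]))
    (ell : (T -> R[i]) -> R[i]) (L : T -> R[i]) : Prop :=
  V L /\ forall v, V v -> ell v = cinner mu D L v.

Definition approximation_weight (W : T -> R) : Prop :=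
  measurable_fun D W /\ forall x, D x -> 0 < W x.

Definition sampling_density (tau2 : T -> R) : Prop :=
  [/\ measurable_fun D tau2,
      forall x, D x -> 0 <= tau2 x,
      (\int[mu]_(x in D) (tau2 x)%:E = 1)%E
    & {ae mu, forall x, D x -> tau2 x = 0 -> kfun phi x = 0}].

Definition Qsup (tau2 : T -> R) : \bar R :=
  ess_sup (sampling_measure mu D tau2) (kfun_ratio phi tau2).

Definition cos_gamma (ell : (T -> R[i]) -> R[i]) (L : T -> R[i]) (x : T) : R :=
  if 0 < kfun phi x
  then normc (L x) / (dual_norm (span_of phi) ell * Num.sqrt (kfun phi x))
  else 1.

Definition relatively_admissible (tau2 : T -> R)
    (ell : (T -> R[i]) -> R[i]) (L : T -> R[i]) : Prop :=
  (Qsup tau2 < +oo)%E /\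
  (fun e : R => (e ^- 2)%:E *
     sampling_measure mu D tau2 (D `&` [set x | (cos_gamma ell L x <= e)%R]))%E
    @ 0^'+ --> 0%E.

Definition reference_kernel (L : T -> R[i]) (tau2 W : T -> R) (x : T) : R :=
  if tau2 x == 0 then 0 else normc (L x) / (tau2 x * W x).

Definition reference_weight_concentration (tau2 : T -> R)
    (L : T -> R[i]) (W : T -> R) : Prop :=
  (ereal_inf [set c%:E | c in [set c : R | (0 < c)%R /\
     \int[sampling_measure mu D tau2]_(x in D)
        (expR (reference_kernel L tau2 W x / c)%R)%:E <= 2%:E]] < +oo)%E.

Definition mixture_density (theta : R) (L : T -> R[i]) (W : T -> R) (x : T) : R :=
  theta * induced_density phi x +
  (1 - theta) * (normc (L x) / W x / L1norm mu D (fun y => L y / (W y)%:C)).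

End sampling.

(* Main.v *)
Require Import Defs.
From mathcomp Require Import all_boot all_order all_algebra.
From mathcomp Require Import all_classical all_reals all_analysis.
From mathcomp Require Import complex.
From mathcomp Require Import measurable_realfun ess_sup_inf ring lra.

Set Implicit Arguments.
Unset Strict Implicit.
Unset Printing Implicit Defensive.

Import Order.TTheory GRing.Theory Num.Theory.
Import numFieldNormedType.Exports Normc.

Local Open Scope classical_set_scope.
Local Open Scope complex_scope.
Local Open Scope ring_scope.

(** Write [w = |L| / W] and [M] for its integral, so that
[tau2 = theta * k / N + (1 - theta) * w / M].  Each half of the mixture takes
care of one conclusion.

The term [theta * k / N] bounds [k / tau2] by [N / theta] everywhere on [D]
([mixture_Qsup]).  The term [(1 - theta) * w / M] bounds the reference kernel
[w / tau2] by [M / (1 - theta)] everywhere on [D], and a bounded variable has a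
finite Orlicz norm ([mixture_concentration]).  That [M > 0], without which
[tau2] would not have mass one, is where [ell <> 0] enters: if [M = 0] then
[L = 0] almost everywhere and the Riesz formula kills [ell]
([L1norm_weight_gt0]).

What remains is that the tail [A_e = {cos gamma <= e}] has [rho_theta]-mass
[o(e^2)] ([mixture_tail_cvg]).  Its mass under the first half is [o(e^2)] by
hypothesis.  On [A_e] one has [|L| <= e * nu * sqrt k], with [nu] the dual norm
of [ell], so that the mass under the second half is at most a constant times
[e] times the integral over [A_e] of [sqrt k / W].  By Cauchy-Schwarz this is
at most [e] times the square root of [rho_ind A_e] times the norm of [1 / W];
the square root is itself [o(e)], which supplies the missing factor.  The
proof uses the weighted arithmetic-geometric inequality instead of
Cauchy-Schwarz: for every [v > 0] there is a constant [a] with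
[tau2 <= a * k / N + v * e^2 / W^2] on [A_e] ([mixture_le_tail]), and the last
term integrates to a small multiple of [e^2] because [1 / W] is square
integrable. *)

(** * Closedness of the support *)

(** A point outside the support has an open neighbourhood that is not charged,
and none of the points of that neighbourhood are in the support. *)
Lemma closed_closed_support (R : realType) (E : topologicalType)
    (mu : set E -> \bar R) : closed (closed_support mu).
Proof.
rewrite -[closed_support mu]setCK; apply: open_closedC.
rewrite openE => x; rewrite /setC/closed_support/= => /existsNP[U /not_implyP[oU /not_implyP[Ux muU]]].
apply: (filterS _ (open_nbhs_nbhs (conj oU Ux))).
by move=> y Uy /(_ U oU Uy).
Qed.

(** * Complex-valued measurable functions *)

Lemma normc_ge0 (R : rcfType) (z : R[i]) : 0 <= normc z.
Proof. by case: z => a b; exact: sqrtr_ge0. Qed.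

Lemma normc_real (R : rcfType) (a : R) : normc a%:C = `|a|.
Proof. by rewrite /normc /= expr0n addr0 sqrtr_sqr. Qed.

Lemma normc_div_pos (R : rcfType) (z : R[i]) (a : R) :
  0 < a -> normc (z / a%:C) = normc z / a.
Proof. by move=> a0; rewrite normcM normcV normc_real gtr0_norm. Qed.

Lemma Re_conjM (R : rcfType) (z : R[i]) :
  complex.Re (z^* * z) = normc z ^+ 2.
Proof.
by case: z => a b; rewrite /normc sqr_sqrtr ?addr_ge0 ?sqr_ge0//=; ring.
Qed.

Section measurability.
Context d (T : measurableType d) (R : realType).
Implicit Types (D : set T) (f : T -> R) (u v : T -> R[i]).

Lemma measurable_fun_sqrtr D f :
  measurable_fun D f -> measurable_fun D (fun x => Num.sqrt (f x)).
Proof.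
move=> mf; apply: (measurableT_comp (f := @Num.sqrt R)) => //.
by apply: continuous_measurable_fun; exact: sqrt_continuous.
Qed.

(** Inversion is discontinuous at 0, where it takes the value 0; on nonnegative
reals it is the power function of exponent -1, for all values including 0. *)
Lemma measurable_fun_inv_ge0 D f : (forall x, D x -> 0 <= f x) ->
  measurable_fun D f -> measurable_fun D (fun x => (f x)^-1).
Proof.
move=> f0 mf; apply: (eq_measurable_fun (fun x => f x `^ (-1))).
  by move=> x /set_mem Dx; rewrite powR_inv1// f0.
exact: (measurableT_comp (measurable_powR _)).
Qed.

Lemma measurable_fun_normc D u :
  cmeasurable_fun D u -> measurable_fun D (fun x => normc (u x)).
Proof.
move=> [mr mi].
have -> : (fun x => normc (u x)) = (fun x =>
    Num.sqrt (complex.Re (u x) ^+ 2 + complex.Im (u x) ^+ 2)).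
  by apply/funext => x; case: (u x).
apply: measurable_fun_sqrtr.
by apply: measurable_funD; exact: measurable_funX.
Qed.

Lemma cmeasurable_fun_cst D (c : R[i]) : cmeasurable_fun D (fun=> c).
Proof. by split; exact: measurable_cst. Qed.

Lemma cmeasurable_fun_conj D u :
  cmeasurable_fun D u -> cmeasurable_fun D (fun x => (u x)^*).
Proof.
move=> [mr mi]; split.
  have -> // : (fun x => complex.Re (u x)^*) = (fun x => complex.Re (u x)).
  by apply/funext => x; case: (u x).
have -> : (fun x => complex.Im (u x)^*) = (fun x => - complex.Im (u x)).
  by apply/funext => x; case: (u x).
exact: measurable_funN.
Qed.

Lemma cmeasurable_funM D u v : cmeasurable_fun D u -> cmeasurable_fun D v ->
  cmeasurable_fun D (fun x => u x * v x).
Proof.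
move=> [mru miu] [mrv miv]; split.
  have -> : (fun x => complex.Re (u x * v x)) =
      (fun x => complex.Re (u x) * complex.Re (v x)
                - complex.Im (u x) * complex.Im (v x)).
    by apply/funext => x; case: (u x) (v x) => [a b] [a' b'].
  by apply: measurable_funB; exact: measurable_funM.
have -> : (fun x => complex.Im (u x * v x)) =
    (fun x => complex.Re (u x) * complex.Im (v x)
              + complex.Im (u x) * complex.Re (v x)).
  by apply/funext => x; case: (u x) (v x) => [a b] [a' b'].
by apply: measurable_funD; exact: measurable_funM.
Qed.

Lemma cmeasurable_fun_sum D n (h : 'I_n -> T -> R[i]) :
  (forall i, cmeasurable_fun D (h i)) ->
  cmeasurable_fun D (fun x => \sum_(i < n) h i x).
Proof.
move=> mh; split.
  have -> : (fun x => complex.Re (\sum_(i < n) h i x)) =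
      (fun x => \sum_(i < n) complex.Re (h i x)).
    by apply/funext => x; elim/big_rec2: _ => // i z w _ <-; case: (h i x) w => [a b] [].
  by apply: measurable_sum => i; case: (mh i).
have -> : (fun x => complex.Im (\sum_(i < n) h i x)) =
    (fun x => \sum_(i < n) complex.Im (h i x)).
  by apply/funext => x; elim/big_rec2: _ => // i z w _ <-; case: (h i x) w => [a b] [].
by apply: measurable_sum => i; case: (mh i).
Qed.

Lemma cmeasurable_fun_span D n (phi : 'I_n -> T -> R[i]) v :
  (forall i, cmeasurable_fun D (phi i)) -> span_of phi v -> cmeasurable_fun D v.
Proof.
move=> mphi [c ->]; apply: cmeasurable_fun_sum => i.
by apply: cmeasurable_funM; first exact: cmeasurable_fun_cst.
Qed.

Lemma measurable_kfun D n (phi : 'I_n -> T -> R[i]) :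
  (forall i, cmeasurable_fun D (phi i)) -> measurable_fun D (kfun phi).
Proof.
move=> mphi; apply: measurable_sum => i.
by apply: measurable_funX; exact: measurable_fun_normc.
Qed.

End measurability.

(** * The induced density *)

Lemma kfun_ge0 (T : Type) (R : realType) n (phi : 'I_n -> T -> R[i]) x :
  0 <= kfun phi x.
Proof. by apply: sumr_ge0 => i _; exact: sqr_ge0. Qed.

Lemma induced_density_ge0 (T : Type) (R : realType) n (phi : 'I_n -> T -> R[i])
  x : 0 <= induced_density phi x.
Proof. by rewrite divr_ge0// kfun_ge0. Qed.

Section induced.
Context d (T : measurableType d) (R : realType).
Variables (mu : {measure set T -> \bar R}) (D : set T).

(** The inner product uses the finite part of the integral, which is 0 also when
the integral is infinite; square integrability rules that out. *)
Lemma integral_normc_sq (u : T -> R[i]) : in_L2 mu D u ->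
  cinner mu D u u = 1 -> (\int[mu]_(x in D) (normc (u x) ^+ 2)%:E = 1)%E.
Proof.
move=> [mu_ uoo] /(congr1 (@complex.Re R)) /=; rewrite /Rintegral.
under eq_integral do rewrite Re_conjM.
move=> h; rewrite -[LHS]fineK ?h// ge0_fin_numE//.
by apply: integral_ge0 => x _; rewrite lee_fin sqr_ge0.
Qed.

Lemma measurable_induced_density n (phi : 'I_n -> T -> R[i]) :
  (forall i, cmeasurable_fun D (phi i)) ->
  measurable_fun D (induced_density phi).
Proof.
move=> mphi; apply: measurable_funM; last exact: measurable_cst.
exact: measurable_kfun.
Qed.

Lemma integral_induced_density n (phi : 'I_n -> T -> R[i]) :
  measurable D -> (0 < n)%N -> L2_orthonormal mu D phi ->
  (\int[mu]_(x in D) (induced_density phi x)%:E = 1)%E.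
Proof.
move=> mD n0 [phi2 orth].
have mphi i : cmeasurable_fun D (phi i) by case: (phi2 i).
under eq_integral do rewrite /induced_density mulrC EFinM.
rewrite ge0_integralZl_EFin//; last 2 first.
- by move=> x _; rewrite lee_fin kfun_ge0.
- by apply/measurable_EFinP; exact: measurable_kfun.
under eq_integral do rewrite /kfun -sumEFin.
rewrite ge0_integral_sum//; last 2 first.
- move=> i; apply/measurable_EFinP; apply: measurable_funX.
  exact: measurable_fun_normc.
- by move=> i x _; rewrite lee_fin sqr_ge0.
under eq_bigr => i _ do rewrite integral_normc_sq ?orth ?eqxx//.
rewrite sumEFin sumr_const card_ord -EFinM mulVf// pnatr_eq0.
by rewrite -lt0n.
Qed.

End induced.

(** * Convergence of nonnegative extended reals to zero *)

Lemma cvge0P (I : Type) (F : set_system I) (FF : Filter F) (R : realType)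
    (f : I -> \bar R) : (forall i, (0 <= f i)%E) ->
  f @ F --> 0%E <-> forall e : R, 0 < e -> \forall i \near F, (f i <= e%:E)%E.
Proof.
move=> f0; split=> [/fine_cvgP[ffin /cvgr0Pnorm_le fcvg] e e0|fe].
  near=> i; rewrite -[f i]fineK ?lee_fin; last by near: i.
  by apply: le_trans (ler_norm _) _; near: i; exact: fcvg.
have ffin e : 0 < e -> \forall i \near F, f i \is a fin_num /\ `|fine (f i)| <= e.
  move=> e0; near=> i.
  have fi : (f i <= e%:E)%E by near: i; exact: fe.
  have fin : f i \is a fin_num.
    by rewrite ge0_fin_numE// (le_lt_trans fi)// ltry.
  split=> //; rewrite ger0_norm ?fine_ge0//.
  by rewrite -lee_fin fineK.
apply/fine_cvgP; split; first by apply: filterS (ffin 1 ltr01) => i [].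
by apply/cvgr0Pnorm_le => e /ffin; apply: filterS => i [].
Unshelve. all: by end_near. Qed.

(** Domination up to an arbitrarily small additive constant: the factor [a] may
blow up as [b] tends to 0, since [b] is fixed before the limit is taken. *)
Lemma cvge0_le_small (I : Type) (F : set_system I) (FF : Filter F) (R : realType)
    (f g : I -> \bar R) :
  (forall i, (0 <= f i)%E) -> (forall i, (0 <= g i)%E) ->
  (forall b : R, 0 < b -> exists a : R, 0 <= a /\
     \forall i \near F, (f i <= a%:E * g i + b%:E)%E) ->
  g @ F --> 0%E -> f @ F --> 0%E.
Proof.
move=> f0 g0 fg /(cvge0P _ g0) gcvg; apply/cvge0P => // e e0.
have [|a [a0 fab]] := fg (e / 2); first by rewrite divr_gt0.
have a1 : 0 < a + 1 by rewrite ltr_wpDl.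
near=> i.
have fi : (f i <= a%:E * g i + (e / 2)%:E)%E by near: i.
have gi : (g i <= (e / 2 / (a + 1))%:E)%E.
  by near: i; apply: gcvg; rewrite !divr_gt0.
apply: (le_trans fi); rewrite [e in leRHS]splitr EFinD leeD2r//.
apply: (@le_trans _ _ (a%:E * (e / 2 / (a + 1))%:E)%E).
  by rewrite lee_wpmul2l// lee_fin.
rewrite -EFinM lee_fin mulrCA; apply: ler_piMr; first by rewrite divr_ge0// ltW.
by rewrite ler_pdivrMr// mul1r ler_wpDr.
Unshelve. all: by end_near. Qed.

(** * The mixture density *)

Section mixture.
Context d (T : measurableType d) (R : realType).
Variables (mu : {measure set T -> \bar R}) (D : set T).
Variables (N : nat) (phi : 'I_N -> T -> R[i]).
Implicit Types (ell : (T -> R[i]) -> R[i]) (L : T -> R[i]) (W : T -> R).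

Lemma cinner_ae0 (u v : T -> R[i]) : measurable D ->
  cmeasurable_fun D u -> cmeasurable_fun D v ->
  {ae mu, forall x, D x -> u x = 0} -> cinner mu D u v = 0.
Proof.
move=> mD mu_ mv u0.
have [mre mim] := cmeasurable_funM (cmeasurable_fun_conj mu_) mv.
rewrite /cinner /cintegral /Rintegral.
rewrite (ae_eq_integral (cst 0%E)) ?integral0//; last 2 first.
- exact/measurable_EFinP.
- by apply: filterS u0 => x u0x Dx; rewrite /= u0x//; case: (v x) => a b /=; rewrite !(oppr0, mul0r, subr0, addr0).
rewrite (ae_eq_integral (cst 0%E)) ?integral0//.
- exact/measurable_EFinP.
- by apply: filterS u0 => x u0x Dx; rewrite /= u0x//; case: (v x) => a b /=; rewrite !(oppr0, mul0r, subr0, addr0).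
Qed.

Lemma L1norm_weightE L W : (forall x, D x -> 0 < W x) ->
  in_L1 mu D (fun x => L x / (W x)%:C) ->
  (\int[mu]_(x in D) (normc (L x) / W x)%:E
   = (L1norm mu D (fun x => L x / (W x)%:C))%:E)%E.
Proof.
move=> W0 [_ LWoo]; rewrite /L1norm /Rintegral fineK; last first.
  rewrite ge0_fin_numE//; apply: integral_ge0 => x _.
  by rewrite lee_fin normc_ge0.
by apply: eq_integral => x /set_mem Dx; rewrite normc_div_pos// W0.
Qed.

(** The norm vanishes only if [L] does almost everywhere on [D], and then every
[ell v], being an inner product with [L], is zero. *)
Lemma L1norm_weight_gt0 ell L W : measurable D ->
  (forall n, cmeasurable_fun D (phi n)) ->
  (exists v, span_of phi v /\ ell v <> 0) ->
  riesz_representer mu D (span_of phi) ell L ->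
  (forall x, D x -> 0 < W x) -> in_L1 mu D (fun x => L x / (W x)%:C) ->
  0 < L1norm mu D (fun x => L x / (W x)%:C).
Proof.
move=> mD mphi [v [Vv ellv]] [VL rep] W0 LW.
have LW0 : 0 <= L1norm mu D (fun x => L x / (W x)%:C).
  by apply: Rintegral_ge0 => x _; exact: normc_ge0.
rewrite lt_neqAle LW0 andbT eq_sym; apply/eqP => LWeq0; apply: ellv.
rewrite rep//; apply: cinner_ae0 => //; first exact: cmeasurable_fun_span VL.
  exact: cmeasurable_fun_span Vv.
pose f x := normc (L x / (W x)%:C).
have mf : measurable_fun D (EFin \o f).
  by apply/measurable_EFinP; apply: measurable_fun_normc; case: LW.
have /(ae_eq_integral_abs mu mD mf) : (\int[mu]_(x in D) `|(EFin \o f) x| = 0)%E.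
  rewrite -[RHS]/(0%:E) -LWeq0 -L1norm_weightE//.
  apply: eq_integral => x /set_mem Dx.
  by rewrite /= ger0_norm ?normc_ge0// /f (normc_div_pos _ (W0 _ Dx)).
apply: filterS => x /= h Dx; move: (h Dx) => [].
rewrite /f normc_div_pos ?W0// => /eqP.
by rewrite mulf_eq0 invr_eq0 [W x == 0]gt_eqF ?W0// orbF => /eqP/eq0_normc.
Qed.

Section density.
Variables (theta : R) (L : T -> R[i]) (W : T -> R).
Hypotheses (theta0 : 0 < theta) (theta1 : theta < 1).
Hypotheses (mD : measurable D) (W0 : forall x, D x -> 0 < W x).
Hypotheses (mphi : forall n, cmeasurable_fun D (phi n)).
Hypotheses (mL : cmeasurable_fun D L) (mW : measurable_fun D W).
Let M := L1norm mu D (fun x => L x / (W x)%:C).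
Let tau2 := mixture_density mu D phi theta L W.
Hypothesis (M0 : 0 < M).
Let theta1B : 0 < 1 - theta. Proof. by rewrite subr_gt0. Qed.

Lemma weight_ge0 x : D x -> 0 <= normc (L x) / W x.
Proof. by move=> Dx; rewrite divr_ge0 ?normc_ge0// ltW// W0. Qed.

Lemma measurable_weight : measurable_fun D (fun x => normc (L x) / W x).
Proof.
apply: measurable_funM; first exact: measurable_fun_normc.
by apply: measurable_fun_inv_ge0 => // x Dx; rewrite ltW// W0.
Qed.

(** The source of the bound on [k / tau2]. *)
Lemma mixture_ge_induced x : D x -> theta * induced_density phi x <= tau2 x.
Proof.
by move=> Dx; rewrite lerDl mulr_ge0 ?(ltW theta1B)// divr_ge0 ?weight_ge0// ltW.
Qed.

(** The source of the bound on the reference kernel. *)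
Lemma mixture_ge_weight x : D x -> (1 - theta) / M * (normc (L x) / W x) <= tau2 x.
Proof.
move=> Dx; rewrite [leLHS](_ : _ = (1 - theta) * (normc (L x) / W x / M)); last first.
  by rewrite mulrAC -mulrA.
by rewrite lerDr mulr_ge0 ?induced_density_ge0// ltW.
Qed.

Lemma mixture_density_ge0 x : D x -> 0 <= tau2 x.
Proof.
move=> Dx; apply: le_trans (mixture_ge_induced Dx).
by rewrite mulr_ge0 ?induced_density_ge0// ltW.
Qed.

Lemma mixture_eq0 x : (0 < N)%N -> D x -> tau2 x = 0 -> kfun phi x = 0.
Proof.
move=> N0 Dx tau0; have := mixture_ge_induced Dx; rewrite tau0 => h.
have : induced_density phi x <= 0 by rewrite -(pmulr_rle0 _ theta0).
rewrite /induced_density pmulr_lle0 ?invr_gt0 ?ltr0n// => k0.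
by apply/eqP; rewrite eq_le k0 kfun_ge0.
Qed.

Lemma measurable_mixture_density : measurable_fun D tau2.
Proof.
apply: measurable_funD.
  by apply: measurable_funM; [exact: measurable_cst|exact: measurable_induced_density].
apply: measurable_funM; first exact: measurable_cst.
by apply: measurable_funM; [exact: measurable_weight|exact: measurable_cst].
Qed.

Lemma mixture_sampling_density : (0 < N)%N -> L2_orthonormal mu D phi ->
  in_L1 mu D (fun x => L x / (W x)%:C) -> sampling_density mu D phi tau2.
Proof.
move=> N0 orth LW; split.
- exact: measurable_mixture_density.
- exact: mixture_density_ge0.
- have mk := measurable_induced_density mphi.
  have mw := measurable_weight.
  rewrite (eq_integral (fun x => theta%:E * (induced_density phi x)%:E
      + ((1 - theta) / M)%:E * (normc (L x) / W x)%:E)%E); last first.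
    by move=> x _; rewrite -!EFinM -EFinD; congr (_%:E); rewrite /tau2 /mixture_density -/M; ring.
  have c0 : 0 <= (1 - theta) / M by rewrite divr_ge0// ltW.
  rewrite ge0_integralD//; last 4 first.
  + by move=> x _; rewrite lee_fin mulr_ge0 ?induced_density_ge0// ltW.
  + by apply: measurable_funeM; exact/measurable_EFinP.
  + by move=> x Dx; rewrite lee_fin mulr_ge0// weight_ge0.
  + by apply: measurable_funeM; exact/measurable_EFinP.
  rewrite ge0_integralZl_EFin//; last 3 first.
  + by move=> x _; rewrite lee_fin induced_density_ge0.
  + exact/measurable_EFinP.
  + exact: ltW.
  rewrite ge0_integralZl_EFin//; last 2 first.
  + by move=> x Dx; rewrite lee_fin weight_ge0.
  + exact/measurable_EFinP.
  rewrite integral_induced_density// L1norm_weightE// -/M mule1 -EFinM -EFinD.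
  by rewrite divfK ?gt_eqF// subrKC.
- by apply: aeW => x; exact: mixture_eq0.
Qed.

(** The bound [k / tau2 <= N / theta] holds at every point of [D]; the sampling
measure does not charge the complement of [D]. *)
Lemma mixture_Qsup : (0 < N)%N -> (Qsup mu D phi tau2 < +oo)%E.
Proof.
move=> N0; apply: (@le_lt_trans _ _ (N%:R / theta)%:E); last exact: ltry.
apply/ess_supP; exists (~` D); split; first exact: measurableC.
  rewrite /= (sampling_measureE mu _ mD measurable_mixture_density).
    by rewrite setICl integral_set0.
  exact: mixture_density_ge0.
move=> x; apply: contra_not => Dx; rewrite /= /kfun_ratio.
have [tau0|tau0] := eqVneq (tau2 x) 0.
  by rewrite (mixture_eq0 N0 Dx tau0) eqxx lee_fin divr_ge0// ltW.
have taugt0 : 0 < tau2 x by rewrite lt_neqAle eq_sym tau0 mixture_density_ge0.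
rewrite lee_fin ler_pdivrMr// mulrAC ler_pdivlMr//.
have := mixture_ge_induced Dx; rewrite /induced_density mulrA ler_pdivrMr ?ltr0n//.
by rewrite mulrC [tau2 x * _]mulrC.
Qed.

(** The case distinction is absorbed by the convention that 0 has inverse 0; this
form makes measurability clear. *)
Lemma reference_kernelE :
  reference_kernel L tau2 W = (fun x => normc (L x) / (tau2 x * W x)).
Proof.
apply/funext => x; rewrite /reference_kernel.
by case: ifPn => // /eqP ->; rewrite mul0r invr0 mulr0.
Qed.

Lemma reference_kernel_le x : D x -> reference_kernel L tau2 W x <= M / (1 - theta).
Proof.
move=> Dx; rewrite /reference_kernel; case: ifPn => [_|tau0].
  by rewrite divr_ge0// ltW.
have taugt0 : 0 < tau2 x by rewrite lt_neqAle eq_sym tau0 mixture_density_ge0.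
rewrite ler_pdivrMr ?mulr_gt0 ?W0// mulrA -ler_pdivrMr ?W0//.
rewrite -[M / (1 - theta)]invf_div ler_pdivlMl ?divr_gt0//.
exact: mixture_ge_weight.
Qed.

(** The kernel is at most [M / (1 - theta)] on [D], so dividing it by
[M / ((1 - theta) * ln 2)] keeps its exponential below 2. *)
Lemma mixture_concentration : sampling_density mu D phi tau2 ->
  reference_weight_concentration mu D tau2 L W.
Proof.
move=> [mt t0 t1 _].
have ln2 : 0 < ln 2 :> R by rewrite ln_gt0// ltr1n.
pose c := M / (1 - theta) / ln 2.
have c0 : 0 < c by rewrite !divr_gt0.
apply: (@le_lt_trans _ _ c%:E); last exact: ltry.
apply: ereal_inf_lbound; exists c => //; split => //.
apply: (@le_trans _ _ (\int[sampling_measure mu D tau2]_(x in D) (cst 2%:E) x)%E).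
  apply: ge0_le_integral => //.
  - apply/measurable_EFinP.
    apply: (measurableT_comp (@measurable_expR R)).
    apply: measurable_funM; last exact: measurable_cst.
    rewrite reference_kernelE; apply: measurable_funM.
      exact: measurable_fun_normc.
    apply: measurable_fun_inv_ge0; last exact: measurable_funM.
    by move=> x Dx; rewrite mulr_ge0 ?t0// ltW// W0.
  - move=> x Dx; rewrite /= lee_fin -[leRHS]lnK ?posrE// ler_expR.
    rewrite ler_pdivrMr// /c mulrC divfK ?gt_eqF//.
    exact: reference_kernel_le.
rewrite integral_cst//= (sampling_measureE mu _ mD mt t0) setIid t1 mule1//.
Qed.

(** * Tails of the angle *)

(** The gap is the square of [2 * v * w - c * s], over [4 * v]. *)
Lemma AMGM_weighted (F : realFieldType) (v c s w : F) : 0 < v ->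
  c * (s * w) <= v * w ^+ 2 + c ^+ 2 / (4 * v) * s ^+ 2.
Proof.
move=> v0; rewrite -subr_ge0.
rewrite [leRHS](_ : _ = (2 * v * w - c * s) ^+ 2 / (4 * v)); last first.
  by field; rewrite gt_eqF.
by rewrite divr_ge0 ?sqr_ge0// mulr_ge0// ltW.
Qed.

Variable ell : (T -> R[i]) -> R[i].
Let nu := dual_norm mu D (span_of phi) ell.
Let tail (e : R) := D `&` [set x | cos_gamma mu D phi ell L x <= e].

(** For [e < 1] the points with [k = 0], where the cosine is 1, are excluded; on
the others the quotient can be cleared, which makes the tail measurable. *)
Lemma tailE e : 0 < nu -> 0 < e -> e < 1 ->
  tail e = (D `&` [set x | normc (L x) <= e * (nu * Num.sqrt (kfun phi x))])
           `\` (D `&` [set x | kfun phi x <= 0]).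
Proof.
move=> nu0 e0 e1; apply/seteqP; split=> x; rewrite /tail /cos_gamma /= -/nu.
  move=> [Dx]; case: ifPn => [k0|_ /(lt_le_trans e1)]; last by rewrite ltxx.
  rewrite ler_pdivrMr ?mulr_gt0 ?sqrtr_gt0// => h; split=> //.
  by move=> [_]; rewrite leNgt k0.
move=> [[Dx h] k0]; split=> //.
case: ifPn => [kx|]; last by rewrite -leNgt => /(conj Dx)/k0.
by rewrite ler_pdivrMr ?mulr_gt0 ?sqrtr_gt0.
Qed.

Lemma measurable_tail e : 0 < nu -> 0 < e -> e < 1 -> measurable (tail e).
Proof.
move=> nu0 e0 e1; rewrite tailE//.
have mk := measurable_kfun mphi.
apply: measurableD; apply: measurable_fun_le => //.
  exact: measurable_fun_normc.
apply: measurable_funM => //; apply: measurable_funM => //.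
exact: measurable_fun_sqrtr.
Qed.

(** The dual norm is a real supremum, hence 0 if the unit ball had unbounded
image, and it divides in the cosine.  Its positivity can be read off the tail
condition: otherwise the cosine is nonpositive wherever [k > 0], every tail has
full mass under the induced measure, and [e^-2] times that mass does not tend
to 0. *)
Lemma dual_norm_gt0 : (0 < N)%N -> L2_orthonormal mu D phi ->
  relatively_admissible mu D phi (induced_density phi) ell L -> 0 < nu.
Proof.
move=> N0 orth [_ adm]; rewrite ltNge; apply/negP => nu0.
have tail1 e : 0 < e -> sampling_measure mu D (induced_density phi) (tail e) = 1%E.
  move=> e0; rewrite -(integral_induced_density mD N0 orth).
  rewrite sampling_measureE//; last 2 first.
  - exact: measurable_induced_density.
  - by move=> x _; exact: induced_density_ge0.
  (* Extending by zero compares the integrals over the tail and over [D]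
     pointwise: the density vanishes on the part of [D] outside the tail. *)
  rewrite integral_mkcond [RHS]integral_mkcond.
  apply: eq_integral => x _; rewrite !patchE.
  have [Dx|nDx] := boolP (x \in D); last first.
    by rewrite memNset// => -[_ /mem_set]; rewrite (negbTE nDx).
  case: ifPn => //; apply: contraNeq => sx.
  have kx : 0 < kfun phi x.
    rewrite lt_neqAle kfun_ge0 eq_sym andbT; apply: contra sx => /eqP kx.
    by rewrite /induced_density kx mul0r.
  rewrite inE; split; last exact: set_mem.
  split; first exact: set_mem.
  rewrite /= /cos_gamma kx -/nu (le_trans _ (ltW e0))//.
  rewrite mulr_ge0_le0 ?normc_ge0// invr_le0.
  by rewrite mulr_le0_ge0 ?sqrtr_ge0.
move: adm => /cvge0P adm.
near (0 : R)^'+ => e.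
have e0 : 0 < e by near: e; exact: nbhs_right_gt.
have e1 : e < 1 by near: e; exact: nbhs_right_lt.
have : ((e ^- 2)%:E * sampling_measure mu D (induced_density phi) (tail e)
        <= (2^-1)%:E)%E.
  near: e; apply: adm; last by rewrite invr_gt0.
  by move=> i; rewrite mule_ge0// lee_fin invr_ge0 sqr_ge0.
rewrite tail1// mule1 lee_fin lef_pV2 ?posrE ?exprn_gt0//.
have : e ^+ 2 <= 1 by rewrite expr_le1// ltW.
lra.
Unshelve. all: by end_near. Qed.

(** On the tail the weight part is at most [c * sqrt k * (e / W)]; the weighted
arithmetic-geometric inequality splits this product into a multiple of [k],
with a constant independent of [e], and a multiple [v] of [(e / W)^2], with [v]
as small as desired. *)
Lemma mixture_le_tail (v : R) : (0 < N)%N -> 0 < nu -> 0 < v ->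
  exists2 a : R, 0 <= a & forall e x, 0 < e -> e < 1 -> tail e x ->
    tau2 x <= a * induced_density phi x + v * e ^+ 2 * (W x)^-1 ^+ 2.
Proof.
move=> N0 nu0 v0; pose c := (1 - theta) / M * nu.
have c0 : 0 <= c by rewrite mulr_ge0 ?divr_ge0// ltW.
exists (theta + c ^+ 2 / (4 * v) * N%:R).
  by rewrite addr_ge0 ?mulr_ge0 ?invr_ge0 ?sqr_ge0 ?mulr_ge0// ltW.
move=> e x e0 e1; rewrite tailE// => -[[Dx Lx] _].
have W0x := W0 Dx; have k0 := kfun_ge0 phi x.
have Nn0 : N%:R != 0 :> R by rewrite pnatr_eq0 -lt0n.
have -> : tau2 x = theta * induced_density phi x
                  + (1 - theta) / M * (normc (L x) * (W x)^-1).
  by rewrite /tau2 /mixture_density -/M; congr (_ + _); ring.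
rewrite [(theta + _) * _]mulrDl -addrA lerD2l.
apply: (@le_trans _ _ (c * (Num.sqrt (kfun phi x) * (e / W x)))).
  rewrite [leRHS](_ : _ =
      (1 - theta) / M * (e * (nu * Num.sqrt (kfun phi x)) * (W x)^-1)); last first.
    by rewrite /c; ring.
  have iW : 0 <= (W x)^-1 by rewrite invr_ge0 ltW.
  have cM : 0 <= (1 - theta) / M by rewrite divr_ge0// ltW.
  exact: ler_wpM2l cM _ _ (ler_wpM2r iW Lx).
apply: (le_trans (AMGM_weighted c _ _ v0)).
rewrite sqr_sqrtr// [(e / W x) ^+ 2]exprMn [v * (_ * _)]mulrA addrC lerD2l.
by rewrite -[leRHS]mulrA /induced_density [N%:R * _]mulrC divfK.
Qed.

(** Integrating the pointwise bound over the tail and dividing by [e^2] leaves a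
constant times the corresponding quantity for the induced measure, which tends
to 0, plus [v] times the integral of [W^-2], which is an arbitrarily small
constant. *)
Lemma mixture_tail_cvg : (0 < N)%N -> L2_orthonormal mu D phi ->
  in_L2 mu D (fun x => ((W x)^-1)%:C) ->
  relatively_admissible mu D phi (induced_density phi) ell L ->
  ((fun e : R => (e ^- 2)%:E * sampling_measure mu D tau2 (tail e)) @ 0^'+
     --> 0)%E.
Proof.
move=> N0 orth [_ W2] adm; have nu0 := dual_norm_gt0 N0 orth adm.
case: adm => _; apply: cvge0_le_small.
- by move=> e; rewrite mule_ge0// lee_fin invr_ge0 sqr_ge0.
- by move=> e; rewrite mule_ge0// lee_fin invr_ge0 sqr_ge0.
move=> b b0.
have iW0 x : D x -> (0 <= ((W x)^-1 ^+ 2)%:E)%E by rewrite lee_fin sqr_ge0.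
have mW2 : measurable_fun D (fun x => (W x)^-1 ^+ 2).
  by apply: measurable_funX; apply: measurable_fun_inv_ge0 => // x /W0/ltW.
pose C := fine (\int[mu]_(x in D) ((W x)^-1 ^+ 2)%:E)%E.
have CE : (\int[mu]_(x in D) ((W x)^-1 ^+ 2)%:E = C%:E)%E.
  rewrite fineK// ge0_fin_numE ?integral_ge0//; move: W2.
  by under eq_integral do rewrite normc_real real_normK ?num_real//.
have C0 : 0 <= C by rewrite fine_ge0// integral_ge0.
(* [C] may vanish, hence the shift; [v * C <= b] is all that matters. *)
pose v := b / (C + 1).
have v0 : 0 < v by rewrite divr_gt0// ltr_wpDl.
have [a a0 ale] := mixture_le_tail N0 nu0 v0.
exists a; split=> //; near=> e.
have e0 : 0 < e by near: e; exact: nbhs_right_gt.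
have e1 : e < 1 by near: e; exact: nbhs_right_lt.
have mA := measurable_tail nu0 e0 e1.
have AD : tail e `<=` D by move=> x [].
have mS := measurable_induced_density mphi.
have S0 x : D x -> 0 <= induced_density phi x by move=> _; exact: induced_density_ge0.
have step : (sampling_measure mu D tau2 (tail e) <=
    a%:E * sampling_measure mu D (induced_density phi) (tail e)
    + (v * e ^+ 2 * C)%:E)%E.
  rewrite !sampling_measureE//; last 2 first.
  - exact: measurable_mixture_density.
  - exact: mixture_density_ge0.
  rewrite (setIidl AD).
  have vol : (\int[mu]_(x in tail e) ((W x)^-1 ^+ 2)%:E <= C%:E)%E.
    by rewrite -CE; apply: ge0_subset_integral => //; exact/measurable_EFinP.
  have ve0 : 0 <= v * e ^+ 2 by rewrite mulr_ge0 ?sqr_ge0// ltW.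
  have mSA := measurable_funS mD AD mS.
  have mWA := measurable_funS mD AD mW2.
  apply: (@le_trans _ _ (\int[mu]_(x in tail e) (a%:E * (induced_density phi x)%:E
      + (v * e ^+ 2)%:E * ((W x)^-1 ^+ 2)%:E))%E).
    apply: ge0_le_integral => //.
    - by move=> x /AD Dx; rewrite lee_fin mixture_density_ge0.
    - apply/measurable_EFinP.
      exact: measurable_funS mD AD measurable_mixture_density.
    - by apply: emeasurable_funD; apply: measurable_funeM; exact/measurable_EFinP.
    - by move=> x Ax; rewrite -!EFinM -EFinD lee_fin; exact: ale Ax.
  rewrite ge0_integralD//; last 4 first.
  - by move=> x /AD Dx; rewrite lee_fin mulr_ge0// S0.
  - by apply: measurable_funeM; exact/measurable_EFinP.
  - by move=> x /AD Dx; rewrite lee_fin mulr_ge0// sqr_ge0.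
  - by apply: measurable_funeM; exact/measurable_EFinP.
  rewrite !ge0_integralZl_EFin//; last 4 first.
  - by move=> x /AD Dx; exact: iW0.
  - exact/measurable_EFinP.
  - by move=> x /AD Dx; rewrite lee_fin S0.
  - exact/measurable_EFinP.
  by rewrite leeD2l// [leRHS]EFinM lee_wpmul2l// lee_fin.
have e2 : 0 < e ^- 2 by rewrite invr_gt0 exprn_gt0.
apply: (le_trans (lee_wpmul2l _ step)); first by rewrite lee_fin ltW.
rewrite muleDr ?fin_num_adde_defl//.
rewrite muleCA leeD2l// -EFinM lee_fin.
rewrite [leLHS](_ : _ = v * C); last by field; rewrite gt_eqF.
rewrite /v mulrAC ler_pdivrMr ?ltr_wpDl// ler_pM2l// lerDl//.
Unshelve. all: by end_near. Qed.

End density.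
End mixture.

(* S is any sigma-algebra containing the Borel sets of E (the Borel sets
   themselves, or their mu-completion). *)
Theorem lemma2p13 (R : realType) (E : completeNormedModType R)
    (S : set (set E)) (hS : sigma_algebra [set: E] S)
    (hSopen : forall U : set E, open U -> S U)
    (mu : {measure set (g_sigma_algebraType S) -> \bar R})
    (D : set E) (hD : D = closed_support mu)
    (N : nat) (hN : (1 <= N)%N)
    (phi : 'I_N -> E -> R[i]) (hphi : L2_orthonormal mu D phi)
    (ell : (E -> R[i]) -> R[i]) (hell : linear_on (span_of phi) ell)
    (hell0 : exists v, span_of phi v /\ ell v <> 0)
    (L : E -> R[i]) (hL : riesz_representer mu D (span_of phi) ell L)
    (W : E -> R) (hW : approximation_weight (T := g_sigma_algebraType S) D W)
    (hLW : in_L1 mu D (fun x => L x / (W x)%:C))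
    (hW2 : in_L2 mu D (fun x => ((W x)^-1)%:C))
    (hadm : relatively_admissible mu D phi (induced_density phi) ell L)
    (theta : R) (htheta0 : 0 < theta) (htheta1 : theta < 1) :
  let tau2 := mixture_density mu D phi theta L W in
  [/\ sampling_density mu D phi tau2,
      relatively_admissible mu D phi tau2 ell L
    & reference_weight_concentration mu D tau2 L W].
Proof.
move=> tau2.
have mD : measurable (D : set (g_sigma_algebraType S)).
  rewrite -[D]setCK; apply: measurableC; apply: sub_sigma_algebra.
  by apply: hSopen; apply: closed_openC; rewrite hD; exact: closed_closed_support.
have mphi n : cmeasurable_fun (T := g_sigma_algebraType S) D (phi n).
  by case: hphi => /(_ n)[].
have [mW W0] := hW.
have mL : cmeasurable_fun (T := g_sigma_algebraType S) D L.
  by case: hL => VL _; exact: cmeasurable_fun_span mphi VL.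
have M0 := L1norm_weight_gt0 mD mphi hell0 hL W0 hLW.
have sd := mixture_sampling_density htheta0 htheta1 mD W0 mphi mL mW M0 hN hphi hLW.
split => //.
  split; first exact: mixture_Qsup.
  exact: mixture_tail_cvg.
exact: mixture_concentration sd.
Qed.
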